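(* Suppose $|a|_p=\alpha=\beta$. For $x\in S_\alpha(0)\setminus\{\hat x_1,\hat x_2\}$ put $\hat\alpha(x)=|f(x)|_p$. Then the $p$-adic dynamical system generated by $f$ has the following properties. 1. (1.1) $SI(x_1)=U_\alpha(0)$. (1.2) $U_\alpha(0)\cap\mathcal P=\emptyset$. 2. If $r>\alpha$ and $x\in S_r(0)\setminus\mathcal P$, then $f(x)\in S_\alpha(0)$. 3. Let $f^k(x)\in S_\alpha(0)\setminus\mathcal P$ for some $k\in\{0,1,2,\dots\}$. Then: if $\hat\alpha(f^k(x))\ge\alpha$, then $f^{k+1}(x)\in S_{\hat\alpha(f^k(x))}(0)$; if $\hat\alpha(f^k(x))>\alpha$, then $f^{k+2}(x)\in S_\alpha(0)$; if $\hat\alpha(f^k(x))<\alpha$, then $f^m(x)\in S_{\hat\alpha(f^k(x))}(0)$ for all $m\ge k+1$. 4. If $|d|_p<\alpha$, then $|x_2|_p=\alpha$ and (4.1) if $|b+(a-d)a|_p<\alpha^2$, then $x_2$ is a repeller fixed point of $f$ and the inequality $|f(x)-x_2|_p>|x-x_2|_p$ holds for all $x\in U_\alpha(x_2)\setminus\{\hat x_1,\hat x_2\}$, $x\ne x_2$; (4.2) if $|b+(a-d)a|_p=\alpha^2$, then $x_2$ is an indifferent fixed point of $f$ and $SI(x_2)=U_\alpha(x_2)$. 5. If $|x_2|_p<\alpha$, then $x_2$ is an indifferent fixed point of $f$ and $SI(x_2)=SI(x_1)$.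
   Context: $p$ is a prime and $\mathbb C_p$ is the field of complex $p$-adic numbers with norm $|\cdot|_p$. Let $a,b,d\in\mathbb C_p$ with $ab\neq0$, $a\ne d$, and $$f(x)=\frac{ax^2+bx}{x^2+dx+b},\qquad x\in\mathbb C_p\setminus\{\hat x_1,\hat x_2\},$$ where $\hat x_1,\hat x_2\in\mathbb C_p$ are the two (possibly equal) roots of $x^2+dx+b$. Put $\alpha=|\hat x_1|_p$, $\beta=|\hat x_2|_p$, labelled so that $\alpha\le\beta$. Standing assumption: $f$ has the two distinct fixed points $x_1=0$ and $x_2=a-d$ (in particular $x_2\notin\{\hat x_1,\hat x_2\}$, i.e. $b+a(a-d)\neq0$). $\mathcal P=\{x\in\mathbb C_p:\exists n\in\mathbb N\cup\{0\},\ f^n(x)\in\{\hat x_1,\hat x_2\}\}$, where $f^n$ is the $n$-th iterate ($f^0=\mathrm{id}$). For $c\in\mathbb C_p$, $r\geq 0$: $U_r(c)=\{x:|x-c|_p<r\}$, $V_r(c)=\{x:|x-c|_p\le r\}$, $S_r(c)=\{x:|x-c|_p=r\}$ (so $S_0(0)=\{0\}$). A fixed point $x_0$ is attractive, indifferent, repeller if $|f'(x_0)|_p<1$, $=1$, $>1$ respectively. A sphere $S$ is invariant if $f$ is defined on $S$ and $f(S)\subset S$. An open ball $U_r(x_0)$ about a fixed point $x_0$ is a Siegel disk if every sphere $S_\rho(x_0)$, $0<\rho<r$, is invariant; $SI(x_0)$ is the union of all Siegel disks centred at $x_0$ (the maximal Siegel disk). *)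

(* Defs.v *)
From HB Require Import structures.
From mathcomp Require Import all_boot all_order all_algebra.
From mathcomp Require Import boolp classical_sets reals.
Set Implicit Arguments.
Unset Strict Implicit.
Unset Printing Implicit Defensive.
Import Order.TTheory GRing.Theory Num.Theory.
Local Open Scope classical_set_scope.
Local Open Scope ring_scope.

(* The field of complex p-adic numbers.

   [is_Cp v p] says that the field [K], normed by [v], is the completion of an
   algebraic closure of [Q_p] with the norm extending the p-adic one; this
   determines [(K, v)] up to isometric isomorphism.  The copy of [Q_p] inside
   the complete field [K] is the topological closure of the rationals. *)

Definition padic_norm (R : realType) (p : nat) (q : rat) : R :=
  if q == 0 then 0
  else p%:R ^ ((logn p `|denq q|)%:Z - (logn p `|numq q|)%:Z).

Section NormedField.
Variables (R : realType) (K : fieldType) (v : K -> R).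

Definition is_ultrametric_norm : Prop :=
  [/\ forall x, 0 <= v x,
      forall x, v x = 0 <-> x = 0,
      forall x y, v (x * y) = v x * v y
    & forall x y, v (x + y) <= Num.max (v x) (v y)].

Definition is_cauchy (u : nat -> K) : Prop :=
  forall e : R, 0 < e ->
    exists N, forall m n, (N <= m)%N -> (N <= n)%N -> v (u m - u n) < e.

Definition converges_to (u : nat -> K) (l : K) : Prop :=
  forall e : R, 0 < e -> exists N, forall n, (N <= n)%N -> v (u n - l) < e.

Definition is_complete : Prop :=
  forall u, is_cauchy u -> exists l, converges_to u l.

Definition norm_closure (A : set K) : set K :=
  [set x | forall e : R, 0 < e -> exists y, A y /\ v (x - y) < e].

Definition Qp : set K := norm_closure (range (fun q : rat => ratr q : K)).

Definition Qpbar : set K :=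
  [set x | exists P : {poly K}, [/\ P != 0, forall i, Qp P`_i & root P x]].

Definition is_Cp (p : nat) : Prop :=
  [/\ is_ultrametric_norm,
      forall q : rat, v (ratr q) = padic_norm R p q,
      is_complete,
      forall P : {poly K}, (1 < size P)%N -> (forall i, Qpbar P`_i) ->
        exists x, Qpbar x /\ root P x
    & norm_closure Qpbar = setT].

Definition oball (r : R) (c : K) : set K := [set x | v (x - c) < r].
Definition sphere (r : R) (c : K) : set K := [set x | v (x - c) = r].

(* [iterate g n x] is [None] as soon as the orbit of [x] leaves the domain of
   [g] before time [n]. *)
Fixpoint iterate (g : K -> option K) (n : nat) (x : K) : option K :=
  if n is n'.+1 then obind g (iterate g n' x) else Some x.

Definition lands_in (o : option K) (A : set K) : Prop :=
  exists y, o = Some y /\ A y.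

Variable g : K -> option K.

Definition is_fixed (x0 : K) : Prop := g x0 = Some x0.

Definition has_derivative (x0 L : K) : Prop :=
  exists y0, g x0 = Some y0 /\
    forall e : R, 0 < e -> exists delta : R, 0 < delta /\
      forall x, x != x0 -> v (x - x0) < delta ->
        exists y, g x = Some y /\ v ((y - y0) / (x - x0) - L) < e.

Definition is_indifferent (x0 : K) : Prop :=
  is_fixed x0 /\ exists L, has_derivative x0 L /\ v L = 1.

Definition is_repeller (x0 : K) : Prop :=
  is_fixed x0 /\ exists L, has_derivative x0 L /\ 1 < v L.

Definition is_invariant (A : set K) : Prop :=
  forall x, A x -> lands_in (g x) A.

Definition is_siegel_disk (x0 : K) (r : R) : Prop :=
  [/\ is_fixed x0, 0 < r
    & forall rho : R, 0 < rho < r -> is_invariant (sphere rho x0)].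

Definition SI (x0 : K) : set K :=
  [set x | exists r : R, is_siegel_disk x0 r /\ oball r x0 x].

Definition pole_orbit (z1 z2 : K) : set K :=
  [set x | exists n, lands_in (iterate g n x) [set z1; z2]].

(* The junk value 0 is taken only outside the domain of [g]. *)
Definition image_norm (x : K) : R := if g x is Some y then v y else 0.

End NormedField.

Definition ratfun (K : fieldType) (a b d x : K) : option K :=
  let D := x ^+ 2 + d * x + b in
  if D == 0 then None else Some ((a * x ^+ 2 + b * x) / D).

(* Main.v *)
Require Import Defs.
From HB Require Import structures.
From mathcomp Require Import all_boot all_order all_algebra.
From mathcomp Require Import boolp classical_sets reals.
From mathcomp Require Import ring.
Set Implicit Arguments.
Unset Strict Implicit.
Unset Printing Implicit Defensive.
Import Order.TTheory GRing.Theory Num.Theory.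
Local Open Scope classical_set_scope.
Local Open Scope ring_scope.

(** Write [D x = x^2 + d x + b = (x - xh1)(x - xh2)] and [x2 = a - d], so that
    [f x = x (a x + b) / D x] and [f x - x2 = (x - x2) (d x + b) / D x].
    Under the hypotheses [|b| = alpha^2] and [|d| <= alpha], and the strict
    ultrametric inequality gives the norms of the three polynomial factors:
    [|a x + b| = |d x + b| = |D x| = alpha^2] for [|x| < alpha], while
    [|a x + b| = alpha |x|] and [|D x| = |x|^2] for [|x| > alpha].  Near [x2]
    one uses [D x = D x2 + (x - x2) (x + x2 + d)], where
    [D x2 = b + (a - d) a].  The Siegel disks cannot be larger because the
    pole [xh1] lies on their boundary sphere. *)

(** * Arithmetic of an ultrametric norm, and Siegel disks bounded by a pole *)

Section UltrametricNorm.
Variables (R : realType) (K : fieldType) (v : K -> R).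
Hypothesis v_norm : is_ultrametric_norm v.

Lemma norm_ge0 x : 0 <= v x.
Proof. by case: v_norm. Qed.

Lemma normM x y : v (x * y) = v x * v y.
Proof. by case: v_norm. Qed.

Lemma norm0 : v 0 = 0.
Proof. by case: v_norm => _ v0 _ _; apply/v0. Qed.

Lemma norm_eq0 x : (v x == 0) = (x == 0).
Proof. by case: v_norm => _ v0 _ _; apply/eqP/eqP => /v0. Qed.

Lemma norm_gt0 x : (0 < v x) = (x != 0).
Proof. by rewrite lt0r norm_ge0 andbT norm_eq0. Qed.

Lemma norm1 : v 1 = 1.
Proof.
have v1_neq0 : v 1 != 0 by rewrite norm_eq0 oner_eq0.
by apply: (mulfI v1_neq0); rewrite -normM !mulr1.
Qed.

Lemma normX x n : v (x ^+ n) = v x ^+ n.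
Proof.
elim: n => [|n IHn]; first by rewrite !expr0 norm1.
by rewrite !exprS normM IHn.
Qed.

Lemma normN x : v (- x) = v x.
Proof.
have vN1 : v (-1) = 1.
  apply/eqP; rewrite -(@eqrXn2 _ 2) ?norm_ge0 //.
  by rewrite -normX sqrrN !expr1n norm1.
by rewrite -mulN1r normM vN1 mul1r.
Qed.

Lemma normBC x y : v (x - y) = v (y - x).
Proof. by rewrite -normN opprB. Qed.

Lemma normV x : v x^-1 = (v x)^-1.
Proof.
have [->|x_neq0] := eqVneq x 0; first by rewrite invr0 norm0 invr0.
have vx_neq0 : v x != 0 by rewrite norm_eq0.
by apply: (mulfI vx_neq0); rewrite -normM !divff // norm1.
Qed.

Lemma norm_addr_le r x y : v x <= r -> v y <= r -> v (x + y) <= r.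
Proof.
case: v_norm => _ _ _ vD xr yr; apply: le_trans (vD x y) _.
by rewrite ge_max xr.
Qed.

Lemma norm_addr_lt r x y : v x < r -> v y < r -> v (x + y) < r.
Proof.
case: v_norm => _ _ _ vD xr yr; apply: le_lt_trans (vD x y) _.
by rewrite gt_max xr.
Qed.

(** Isosceles triangle principle: if the sum were smaller than [y], then [y = (x + y) - x] would be
    smaller than itself. *)
Lemma norm_addr_eq x y : v x < v y -> v (x + y) = v y.
Proof.
move=> xy; apply/eqP; rewrite eq_le norm_addr_le ?(ltW xy) //= leNgt.
apply/negP => xy_y; have := @norm_addr_lt (v y) (x + y) (- x).
by rewrite addrAC subrr add0r normN ltxx => /(_ xy_y xy).
Qed.

Lemma norm_subr_eq x y : v x < v y -> v (x - y) = v y.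
Proof. by rewrite -(normN y); apply: norm_addr_eq. Qed.

(** The sphere through the pole [z] is not invariant, which caps every Siegel disk at radius [r];
    preservation of the distance to [x0] makes all smaller spheres invariant, so the cap is
    attained. *)
Lemma SI_oball (g : K -> option K) (x0 z : K) (r : R) :
  g x0 = Some x0 -> 0 < r -> v (z - x0) = r -> g z = None ->
  (forall x, v (x - x0) < r ->
     exists2 y, g x = Some y & v (y - x0) = v (x - x0)) ->
  SI v g x0 = oball v r x0.
Proof.
move=> gx0 r_gt0 zr gz g_iso; apply/seteqP; split=> [x [s [[_ _ s_inv] xs]]|].
  apply: lt_le_trans xs _; rewrite leNgt; apply/negP => rs.
  by have [y []] := s_inv r (introT andP (conj r_gt0 rs)) z zr; rewrite gz.
move=> x xr; exists r; split=> //; split=> // rho /andP[_ rho_r] y yrho.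
have [|w gw wy] := g_iso y; first by rewrite yrho.
by exists w; split=> //; rewrite /sphere /= wy.
Qed.

End UltrametricNorm.

(** * Factorizations and norm estimates for the rational map *)

Section RationalMap.
Variables (R : realType) (K : fieldType) (v : K -> R).
Hypothesis v_norm : is_ultrametric_norm v.
Variables a b d xh1 xh2 : K.
Hypothesis a_neq0 : a != 0.
Hypothesis root_sum : d = - (xh1 + xh2).
Hypothesis root_prod : b = xh1 * xh2.
Hypothesis norm_a : v a = v xh1.
Hypothesis norm_xh2 : v xh1 = v xh2.

Let f := ratfun a b d.
Let alpha := v xh1.
Let x2 := a - d.
Let D x := x ^+ 2 + d * x + b.

Lemma alpha_gt0 : 0 < alpha.
Proof. by rewrite /alpha -norm_a norm_gt0. Qed.

Lemma norm_b : v b = alpha ^+ 2.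
Proof. by rewrite root_prod normM // -norm_xh2 expr2. Qed.

Lemma norm_d_le : v d <= alpha.
Proof. by rewrite root_sum normN // norm_addr_le // -norm_xh2. Qed.

Lemma norm_x2_le : v x2 <= alpha.
Proof. by rewrite norm_addr_le ?normN ?norm_d_le ?norm_a. Qed.

(** Controls the cofactor of [x - x2] in [denom_shift]. *)
Lemma norm_shift_le x : v (x - x2) <= alpha -> v (x + x2 + d) <= alpha.
Proof.
move=> xa; rewrite norm_addr_le ?norm_d_le // norm_addr_le ?norm_x2_le //.
by rewrite -[x](subrK x2) norm_addr_le ?norm_x2_le.
Qed.

Lemma denom_factor x : D x = (x - xh1) * (x - xh2).
Proof. by rewrite /D root_sum root_prod; ring. Qed.

Lemma denom_x2 : D x2 = b + (a - d) * a.
Proof. by rewrite /D /x2; ring. Qed.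

Lemma denom_shift x : D x = (x - x2) * (x + x2 + d) + D x2.
Proof. by rewrite /D; ring. Qed.

Lemma ratfun_pole x : D x = 0 -> f x = None.
Proof. by rewrite /f /ratfun => /eqP ->. Qed.

Lemma ratfun_def x : D x != 0 -> f x = Some (x * (a * x + b) / D x).
Proof.
by rewrite /f /ratfun => /negPf ->; congr (Some (_ / _)); ring.
Qed.

Lemma ratfun_pole1 : f xh1 = None.
Proof. by rewrite ratfun_pole // denom_factor subrr mul0r. Qed.

(** The distance to [x2] is thus multiplied by [v (d * x + b) / v (D x)]; comparing these two norms
    separates the indifferent case from the repelling one. *)
Lemma ratfun_subx2 x : D x != 0 ->
  x * (a * x + b) / D x - x2 = (x - x2) * (d * x + b) / D x.
Proof. by rewrite /D /x2 => Dx; field. Qed.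

Lemma ratfun_fixed0 : f 0 = Some 0.
Proof.
rewrite ratfun_def ?mul0r // -(norm_gt0 v_norm) /D expr0n mulr0 !add0r norm_b.
by rewrite exprn_gt0 ?alpha_gt0.
Qed.

Lemma ratfun_fixedx2 : D x2 != 0 -> f x2 = Some x2.
Proof.
move=> Dx2; rewrite ratfun_def //; congr Some; apply/eqP; rewrite -subr_eq0.
by rewrite ratfun_subx2 // subrr !mul0r.
Qed.

Lemma norm_affine c x : v (c * x) < alpha ^+ 2 -> v (c * x + b) = alpha ^+ 2.
Proof. by rewrite -norm_b => /norm_addr_eq ->. Qed.

Lemma norm_scale_lt c x : v c <= alpha -> v x < alpha -> v (c * x) < alpha ^+ 2.
Proof.
move=> ca xa; rewrite normM // expr2.
apply: (@le_lt_trans _ _ (alpha * v x)); first by rewrite ler_wpM2r ?norm_ge0.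
by rewrite ltr_pM2l ?alpha_gt0.
Qed.

Lemma norm_denom_in x : v x < alpha -> v (D x) = alpha ^+ 2.
Proof.
by move=> xa; rewrite denom_factor normM // !norm_subr_eq // -norm_xh2.
Qed.

Lemma norm_denom_out x : alpha < v x -> v (D x) = v x ^+ 2.
Proof.
move=> xa; rewrite denom_factor normM // !(normBC _ x) //.
by rewrite !norm_subr_eq // -?norm_xh2 // expr2.
Qed.

Lemma norm_pos_neq0 x r : v x = r -> 0 < r -> x != 0.
Proof. by move=> <-; rewrite norm_gt0. Qed.

Lemma alpha2_gt0 : 0 < alpha ^+ 2.
Proof. by rewrite exprn_gt0 ?alpha_gt0. Qed.

Lemma ratfun_iso0 x : v x < alpha -> exists2 y, f x = Some y & v y = v x.
Proof.
move=> xa; have vD := norm_denom_in xa.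
rewrite ratfun_def; last exact: norm_pos_neq0 vD alpha2_gt0.
exists (x * (a * x + b) / D x) => //.
rewrite !normM // normV // vD norm_affine ?norm_scale_lt ?norm_a //.
by rewrite mulfK // gt_eqF ?alpha2_gt0.
Qed.

Lemma ratfun_out x : alpha < v x -> exists2 y, f x = Some y & v y = alpha.
Proof.
move=> xa; have x_gt0 := lt_trans alpha_gt0 xa; have vD := norm_denom_out xa.
rewrite ratfun_def; last by apply: norm_pos_neq0 vD _; rewrite exprn_gt0.
exists (x * (a * x + b) / D x) => //.
rewrite !normM // normV // vD addrC norm_addr_eq // normM // norm_a; last first.
  by rewrite norm_b expr2 ltr_pM2l ?alpha_gt0.
by rewrite -/alpha mulrCA -expr2 mulfK // expf_neq0 // gt_eqF.
Qed.

Lemma ratfun_iter0 n x : v x < alpha ->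
  exists2 y, iterate f n x = Some y & v y = v x.
Proof.
move=> xa; elim: n => [|n [y /= -> yx]] /=; first by exists x.
by rewrite -yx in xa *; exact: ratfun_iso0.
Qed.

Lemma SI0 : SI v f 0 = oball v alpha 0.
Proof.
apply: SI_oball xh1 alpha _ _ _ _ _ => //; rewrite ?alpha_gt0 ?subr0 //.
- exact: ratfun_fixed0.
- exact: ratfun_pole1.
- by move=> x; rewrite subr0 => /ratfun_iso0[y]; exists y; rewrite ?subr0.
Qed.

(** By [ratfun_subx2] the difference quotient at [x2] is [(d * x + b) / D x], whose limit is its
    value at [x2]. *)
Lemma ratfun_derivative_x2 : D x2 != 0 ->
  has_derivative v f x2 ((d * x2 + b) / D x2).
Proof.
move=> Dx2; have a0 := alpha_gt0; have vD_gt0 : 0 < v (D x2) by rewrite norm_gt0.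
have Dle : v (D x2) <= alpha ^+ 2.
  rewrite denom_factor normM // expr2 ler_pM ?norm_ge0 //.
    by rewrite norm_addr_le ?normN ?norm_x2_le.
  by rewrite norm_addr_le ?normN ?norm_x2_le // -norm_xh2.
have Nle : v (d * x2 + b) <= alpha ^+ 2.
  rewrite norm_addr_le ?norm_b // normM // expr2.
  by rewrite ler_pM ?norm_ge0 ?norm_d_le ?norm_x2_le.
exists x2; split=> [|e e_gt0]; first exact: ratfun_fixedx2.
(* The first bound forces [v (D x) = v (D x2)]; the second absorbs the error term, whose cofactor of
   [x - x2] has a numerator of norm at most [alpha ^+ 3] and a denominator of norm
   [v (D x2) ^+ 2]. *)
exists (Num.min (v (D x2) / alpha) (e * v (D x2) ^+ 2 / alpha ^+ 3)).
split=> [|x]; first by rewrite lt_min !divr_gt0 ?mulr_gt0 ?exprn_gt0.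
rewrite -subr_eq0 lt_min => h_neq0 /andP[]; rewrite !ltr_pdivlMr ?exprn_gt0 //.
move=> hD he; have ha : v (x - x2) <= alpha.
  rewrite -(ler_pM2r a0) -expr2; exact: le_trans (ltW hD) Dle.
have sle := norm_shift_le ha.
have vD : v (D x) = v (D x2).
  rewrite denom_shift norm_addr_eq // normM //; apply: le_lt_trans hD.
  by rewrite ler_wpM2l ?norm_ge0.
have Dx : D x != 0 by apply: norm_pos_neq0 vD _.
rewrite ratfun_def //; eexists; split; first by [].
rewrite ratfun_subx2 //.
have -> : (x - x2) * (d * x + b) / D x / (x - x2) - (d * x2 + b) / D x2 =
    (x - x2) * (d * D x2 - (d * x2 + b) * (x + x2 + d)) / (D x * D x2).
  (* Expanding [D x] around [x2] cancels the constant terms of the cross difference and leaves the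
     factor [x - x2]. *)
  have -> : (x - x2) * (d * D x2 - (d * x2 + b) * (x + x2 + d)) =
      (d * x + b) * D x2 - (d * x2 + b) * D x.
    by rewrite (denom_shift x); ring.
  by field; rewrite h_neq0 Dx Dx2.
rewrite normM // normV // normM // normM // vD -expr2.
rewrite ltr_pdivrMr ?exprn_gt0 //; apply: le_lt_trans he.
rewrite ler_wpM2l ?norm_ge0 // norm_addr_le // ?normN // normM //.
  by rewrite exprS ler_pM ?norm_ge0 ?norm_d_le.
by rewrite exprSr ler_pM ?norm_ge0.
Qed.

(* Clauses 4.2 and 5 are both instances of this: [d * x + b] and [D x] have
   norm [alpha ^+ 2] on the whole ball around [x2]. *)
Lemma indifferent_SI_x2 :
  (forall x, v (x - x2) < alpha -> v (d * x) < alpha ^+ 2) ->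
  v (D x2) = alpha ^+ 2 ->
  is_indifferent v f x2 /\ SI v f x2 = oball v alpha x2.
Proof.
move=> dx vD2; have Dx2 : D x2 != 0 by apply: norm_pos_neq0 vD2 alpha2_gt0.
have a0 := alpha_gt0; have fix2 := ratfun_fixedx2 Dx2.
split.
  split=> //; exists ((d * x2 + b) / D x2); split.
    exact: ratfun_derivative_x2.
  rewrite normM // normV // vD2 norm_affine ?divff ?gt_eqF ?alpha2_gt0 //.
  by rewrite dx // subrr norm0.
have le1 : v (x2 - xh1) <= alpha by rewrite norm_addr_le ?normN ?norm_x2_le.
have le2 : v (x2 - xh2) <= alpha.
  by rewrite norm_addr_le ?normN ?norm_x2_le // -norm_xh2.
(* The distances from [x2] to the two poles are at most [alpha] and their product is [alpha ^+ 2],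
   so neither can be smaller. *)
have xh1_sphere : v (xh1 - x2) = alpha.
  rewrite normBC //; apply/eqP; rewrite eq_le le1 /=.
  rewrite -(ler_pM2r a0) -expr2 -vD2 denom_factor normM //.
  by rewrite ler_wpM2l ?norm_ge0.
apply: (SI_oball fix2 a0 xh1_sphere ratfun_pole1) => x xa.
have sle := norm_shift_le (ltW xa).
have vD : v (D x) = alpha ^+ 2.
  rewrite denom_shift norm_addr_eq // vD2 //.
  by rewrite mulrC norm_scale_lt.
have Dx : D x != 0 by apply: norm_pos_neq0 vD alpha2_gt0.
rewrite ratfun_def //; eexists; first by [].
rewrite ratfun_subx2 // !normM // normV // vD norm_affine ?dx //.
by rewrite mulfK // gt_eqF ?alpha2_gt0.
Qed.

(** By [denom_shift], [v (D x) < alpha ^+ 2] on the whole ball, while [v d < alpha] keeps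
    [v (d * x + b)] at [alpha ^+ 2], so the distance to [x2] grows. The ball contains a pole, hence
    the condition [D x != 0]. *)
Lemma repeller_x2 : v d < alpha -> D x2 != 0 -> v (D x2) < alpha ^+ 2 ->
  is_repeller v f x2 /\
  (forall x, v (x - x2) < alpha -> D x != 0 -> x != x2 ->
     exists y, f x = Some y /\ v (x - x2) < v (y - x2)).
Proof.
move=> da Dx2 vD2.
have vN x : v x <= alpha -> v (d * x + b) = alpha ^+ 2.
  by move=> xa; rewrite norm_affine // mulrC norm_scale_lt.
split.
  split; first exact: ratfun_fixedx2.
  exists ((d * x2 + b) / D x2); split; first exact: ratfun_derivative_x2.
  by rewrite normM // normV // vN ?norm_x2_le // ltr_pdivlMr ?mul1r ?norm_gt0.
move=> x xa Dx xx2.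
have xle : v x <= alpha.
  by rewrite -[x](subrK x2) norm_addr_le ?norm_x2_le // ltW.
have sle := norm_shift_le (ltW xa).
have vD : v (D x) < alpha ^+ 2.
  by rewrite denom_shift norm_addr_lt // mulrC norm_scale_lt.
rewrite ratfun_def //; eexists; split; first by [].
rewrite ratfun_subx2 // !normM // normV // vN // ltr_pdivlMr ?norm_gt0 //.
by rewrite ltr_pM2l // norm_gt0 // subr_eq0.
Qed.

End RationalMap.

Theorem theorem2 (R : realType) (p : nat) (p_prime : prime p)
  (Cp : fieldType) (v : Cp -> R) (HCp : is_Cp v p)
  (a b d xh1 xh2 : Cp) (hab : a * b != 0) (had : a != d)
  (hroots : 'X^2 + d *: 'X + b%:P = ('X - xh1%:P) * ('X - xh2%:P))
  (hx2 : b + a * (a - d) != 0)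
  (hle : v xh1 <= v xh2) (ha : v a = v xh1) (hb : v xh1 = v xh2) :
  let f := ratfun a b d in
  let alpha := v xh1 in
  let x1 : Cp := 0 in
  let x2 : Cp := a - d in
  let poles : set Cp := [set xh1; xh2] in
  let P := pole_orbit f xh1 xh2 in
  let hat_alpha := image_norm v f in
  (* 1 *)
  (SI v f x1 = oball v alpha 0 /\ oball v alpha 0 `&` P = set0) /\
  (* 2 *)
  (forall (r : R) (x : Cp), alpha < r -> (sphere v r 0 `\` P) x ->
     lands_in (f x) (sphere v alpha 0)) /\
  (* 3 *)
  (forall (x : Cp) (k : nat) (y : Cp),
     iterate f k x = Some y -> (sphere v alpha 0 `\` P) y ->
     [/\ alpha <= hat_alpha y ->
           lands_in (iterate f k.+1 x) (sphere v (hat_alpha y) 0),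
         alpha < hat_alpha y ->
           lands_in (iterate f k.+2 x) (sphere v alpha 0)
       & hat_alpha y < alpha ->
           forall m : nat, (k.+1 <= m)%N ->
             lands_in (iterate f m x) (sphere v (hat_alpha y) 0)]) /\
  (* 4 *)
  (v d < alpha ->
     [/\ v x2 = alpha,
         v (b + (a - d) * a) < alpha ^+ 2 ->
           is_repeller v f x2 /\
           (forall x : Cp, (oball v alpha x2 `\` poles) x -> x != x2 ->
              exists y, f x = Some y /\ v (x - x2) < v (y - x2))
       & v (b + (a - d) * a) = alpha ^+ 2 ->
           is_indifferent v f x2 /\ SI v f x2 = oball v alpha x2]) /\
  (* 5 *)
  (v x2 < alpha -> is_indifferent v f x2 /\ SI v f x2 = SI v f x1).
Proof.
have v_norm : is_ultrametric_norm v by case: HCp.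
have a_neq0 : a != 0 by apply: contraNneq hab => ->; rewrite mul0r.
(* Evaluation of the polynomial identity; the points 0 and 1 then yield the Vieta relations. *)
have hD x : x ^+ 2 + d * x + b = (x - xh1) * (x - xh2).
  by have /(congr1 (horner^~ x)) := hroots; rewrite !hornerE.
have hprod : b = xh1 * xh2.
  by have := hD 0; rewrite expr0n mulr0 !add0r mulrNN.
have hsum : d = - (xh1 + xh2).
  have := hD 1; rewrite hprod expr1n mulr1 => h.
  by rewrite -[d](addrK (1 + xh1 * xh2)) addrCA addrA h; ring.
have iter0 := ratfun_iter0 v_norm a_neq0 hsum hprod ha hb.
have out := ratfun_out v_norm a_neq0 hsum hprod ha hb.
have eSI0 := SI0 v_norm a_neq0 hsum hprod ha hb.
have eD2 := denom_x2 a b d.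
have Dx2 : (a - d) ^+ 2 + d * (a - d) + b != 0 by rewrite eD2 mulrC.
have dle : v d <= v xh1 by exact: (norm_d_le v_norm hsum hb).
move=> f alpha x1 x2 poles P hat_alpha; split; last split; last split; last split.
- split; first exact: eSI0.
  apply/seteqP; split=> // x [xa [n [y [fy py]]]]; rewrite /oball /= subr0 in xa.
  have [z fz zx] := iter0 n x xa; move: fy; rewrite fz => -[zy].
  (* Both poles have norm [alpha], but the orbit of [x] keeps the norm [v x], which is smaller. *)
  have : v y = alpha by case: py => ->.
  by rewrite -zy zx => xal; rewrite xal ltxx in xa.
- move=> r x ar []; rewrite /sphere /= subr0 => xr _.
  have [|y fy vy] := out x; first by rewrite xr.
  by exists y; rewrite /sphere /= subr0.
- move=> x k y fk [/= ya yP].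
  have [z fz] : exists z, f y = Some z.
    rewrite /f /ratfun hD; case: eqP => [/eqP|_]; last by eexists.
    (* A pole belongs to [P] already at time 0. *)
    rewrite mulf_eq0 !subr_eq0 => py; case: yP; exists 0%N, y; split=> //.
    by case/orP: py => /eqP ->; [left|right].
  have fk1 : iterate f k.+1 x = Some z by rewrite /= fk.
  have -> : hat_alpha y = v z by rewrite /hat_alpha /image_norm fz.
  split=> [_|za|za m km].
  + by exists z; split; [exact: fk1 | rewrite /sphere /= subr0].
  + have [w fw vw] := out z za; exists w; split; last by rewrite /sphere /= subr0.
    by rewrite /= fk /= fz.
  + have [w fw vw] := iter0 (m - k.+1)%N z za.
    exists w; split; last by rewrite /sphere /= subr0.
    (* With [m = n + k.+1], the orbit of [x] at time [m] is that of [z] at time [n]. *)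
    rewrite -fw -(subnK km); move: (m - k.+1)%N => n.
    rewrite addnK; elim: n => [|n IHn]; first by rewrite add0n.
    by rewrite addSn /= IHn.
- move=> da; have vx2 : v x2 = alpha.
    by rewrite /x2 addrC norm_addr_eq ?normN // ha.
  split=> //; rewrite -eD2 => hD2.
  + have [rep grow] :=
      repeller_x2 v_norm a_neq0 hsum hprod ha hb da Dx2 hD2.
    split=> // x [xa np] xx2; apply: grow => //.
    rewrite hD mulf_eq0 !subr_eq0; apply/negP => px; apply: np.
    by case/orP: px => /eqP ->; [left|right].
  (* Here [v x <= alpha] only, and the strict bound on [d * x] comes from [v d < alpha]. *)
  + apply: (indifferent_SI_x2 v_norm a_neq0 hsum hprod ha hb) => // x xa.
    rewrite mulrC; apply: (norm_scale_lt v_norm a_neq0 ha) => //.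
    by rewrite -[x](subrK x2) norm_addr_le ?vx2 // ltW.
- move=> x2a.
  (* Any point of an ultrametric ball is a centre of it. *)
  have eball : oball v alpha x2 = oball v alpha x1.
    apply/seteqP; split=> x; rewrite /oball /= subr0 => xa.
      by rewrite -[x](subrK x2) norm_addr_lt.
    by rewrite norm_addr_lt ?normN.
  rewrite eSI0 -eball.
  (* Now [d] has norm [alpha], and strictness comes from [v x < alpha] instead. *)
  apply: (indifferent_SI_x2 v_norm a_neq0 hsum hprod ha hb) => [x xa|].
    apply: (norm_scale_lt v_norm a_neq0 ha) => //.
    by rewrite -[x](subrK x2) norm_addr_lt.
  exact: (norm_denom_in v_norm hsum hprod hb).
Qed.
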